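(* Let $c_0,c_1,c_2,c_3\in\mathbb{R}$ with $c_0>0$. The origin of the Moon–Rand system $$\frac{dx}{dt}=y,\qquad \frac{dy}{dt}=-x-xu,\qquad \frac{du}{dt}=-c_0u+c_1x^2+c_2xy+c_3y^2$$ (or, equivalently, of its concomitant complex system) is an isochronous center on the center manifold if and only if $$c_1=c_2=c_3=0 .$$
   Context: Let $\mathbf{i}=\sqrt{-1}$; series are treated as formal power series. Concomitant complex system: with $z=x+\mathbf{i}y$, $w=x-\mathbf{i}y$, $T=-\mathbf{i}t$ the Moon–Rand system becomes $$\frac{dz}{dT}=z+\tfrac12u(z+w),\qquad \frac{dw}{dT}=-w-\tfrac12u(z+w),$$ $$\frac{du}{dT}=-\mathbf{i}c_0u+\tfrac14\mathbf{i}(c_1-c_3-\mathbf{i}c_2)z^2+\tfrac12\mathbf{i}(c_1+c_3)zw+\tfrac14\mathbf{i}(c_1-c_3+\mathbf{i}c_2)w^2 .$$ Write the right-hand sides as $Z(z,w,u)$, $-W(z,w,u)$, $U(z,w,u)$. Reduced complex system: the center manifold has the expansion $u=\tilde u(z,w)$, the unique formal power series without constant and linear terms satisfying $\tilde u_z\,Z(z,w,\tilde u)-\tilde u_w\,W(z,w,\tilde u)=U(z,w,\tilde u)$. The reduced complex system is $\frac{dz}{dT}=Z(z,w,\tilde u(z,w))$, $\frac{dw}{dT}=-W(z,w,\tilde u(z,w))$; it is the complex form of the planar real system obtained by restricting to the center manifold. Isochronous center: for the reduced complex system there are unique formal series $\xi=z+\sum_{k+j\ge2}c_{kj}z^kw^j$,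 $\eta=w+\sum_{k+j\ge2}d_{kj}w^kz^j$ with $c_{k+1,k}=d_{k+1,k}=0$ for $k\ge1$, and unique constants $p_j,q_j$, such that along the reduced system $$\frac{d\xi}{dT}=\xi+\sum_{j\ge1}p_j\xi^{j+1}\eta^j,\qquad \frac{d\eta}{dT}=-\eta-\sum_{j\ge1}q_j\eta^{j+1}\xi^j .$$ The origin of the three-dimensional system is called an isochronous center (on the center manifold) if $p_k=q_k=0$ for all $k\ge1$. *)

(* Defs.v *)
From HB Require Import structures.
From mathcomp Require Import all_boot all_order all_algebra.
From mathcomp Require Import boolp reals complex ring.

Set Implicit Arguments.
Unset Strict Implicit.
Unset Printing Implicit Defensive.

Import Order.TTheory GRing.Theory Num.Theory.
Local Open Scope ring_scope.

Record fps (K : Type) := FPS { fps_coef :> nat -> K }.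

HB.instance Definition _ (K : Type) := gen_eqMixin (fps K).
HB.instance Definition _ (K : Type) := gen_choiceMixin (fps K).

Lemma fpsP (K : Type) (f g : fps K) : (forall n, f n = g n) -> f = g.
Proof. by case: f g => f [g] /= fg; congr FPS; apply/funext. Qed.

Section FpsRing.
Variable K : comNzRingType.
Implicit Types f g h : fps K.

Definition fps_const (c : K) : fps K := FPS (fun n => if n is 0%N then c else 0).
Definition fps_add f g : fps K := FPS (fun n => f n + g n).
Definition fps_opp f : fps K := FPS (fun n => - f n).
Definition fps_mul f g : fps K :=
  FPS (fun n => \sum_(k < n.+1) f k * g (n - k)%N).

Fact fps_addA : associative fps_add.
Proof. by move=> f g h; apply: fpsP => n /=; rewrite addrA. Qed.
Fact fps_addC : commutative fps_add.
Proof. by move=> f g; apply: fpsP => n /=; rewrite addrC. Qed.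
Fact fps_add0 : left_id (fps_const 0) fps_add.
Proof. by move=> f; apply: fpsP => -[|n] /=; rewrite add0r. Qed.
Fact fps_addN : left_inverse (fps_const 0) fps_opp fps_add.
Proof. by move=> f; apply: fpsP => -[|n] /=; rewrite addNr. Qed.

HB.instance Definition _ := GRing.isZmodule.Build (fps K)
  fps_addA fps_addC fps_add0 fps_addN.

Fact fps_mulE f g n : fps_mul f g n = \sum_(k < n.+1) f k * g (n - k)%N.
Proof. by []. Qed.

Fact fps_mul_rev f g n :
  fps_mul f g n = \sum_(k < n.+1) f (n - k)%N * g k.
Proof.
rewrite /= (reindex_inj rev_ord_inj) /=.
by apply: eq_bigr => k _; rewrite (sub_ordK k).
Qed.

Fact fps_mulC : commutative fps_mul.
Proof.
move=> f g; apply: fpsP => n; rewrite fps_mul_rev.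
by apply: eq_bigr => k _; rewrite mulrC.
Qed.

Fact fps_mulA : associative fps_mul.
Proof.
move=> f g h; apply: fpsP => i; rewrite fps_mulE [RHS]fps_mul_rev.
pose coef3 j k := f j * (g (i - j - k)%N * h k).
transitivity (\sum_(j < i.+1) \sum_(k < i.+1 | (k <= i - j)%N) coef3 j k).
  apply: eq_bigr => j _; rewrite fps_mul_rev big_distrr /=.
  by rewrite (big_ord_narrow_leq (leq_subr _ _)).
rewrite (exchange_big_dep predT) //=; apply: eq_bigr => k _.
transitivity (\sum_(j < i.+1 | (j <= i - k)%N) coef3 j k).
  apply: eq_bigl => j; rewrite -ltnS -(ltnS j) -!subSn ?leq_ord //.
  by rewrite -subn_gt0 -(subn_gt0 j) -!subnDA addnC.
rewrite (big_ord_narrow_leq (leq_subr _ _)) big_distrl /=.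
by apply: eq_bigr => j _; rewrite /coef3 -!subnDA addnC mulrA.
Qed.

Fact fps_mul1 : left_id (fps_const 1) fps_mul.
Proof.
move=> f; apply: fpsP => n /=; rewrite big_ord_recl subn0 mul1r.
by rewrite big1 ?addr0 // => k _; rewrite mul0r.
Qed.

Fact fps_mulDl : left_distributive fps_mul fps_add.
Proof.
move=> f g h; apply: fpsP => n /=; rewrite -big_split /=.
by apply: eq_bigr => k _; rewrite mulrDl.
Qed.

Fact fps1_neq0 : fps_const 1 != 0 :> fps K.
Proof.
apply/eqP => /(congr1 (fun f : fps K => f 0%N)) /= /eqP.
by rewrite oner_eq0.
Qed.

HB.instance Definition _ := GRing.Zmodule_isComNzRing.Build (fps K)
  fps_mulA fps_mulC fps_mul1 fps_mulDl fps1_neq0.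

Lemma coef_fps0 n : (0 : fps K) n = 0. Proof. by case: n. Qed.
Lemma coef_fpsD f g n : (f + g) n = f n + g n. Proof. by []. Qed.
Lemma coef_fpsN f n : (- f) n = - f n. Proof. by []. Qed.
Lemma coef_fpsM f g n : (f * g) n = \sum_(k < n.+1) f k * g (n - k)%N.
Proof. by []. Qed.
Lemma coef_fps1 n : (1 : fps K) n = (n == 0%N)%:R. Proof. by case: n. Qed.
Lemma coef_fps_sum I (r : seq I) (P : pred I) (F : I -> fps K) n :
  (\sum_(i <- r | P i) F i) n = \sum_(i <- r | P i) F i n.
Proof.
by elim/big_rec2: _ => [|i y x _ <-]; rewrite ?coef_fps0.
Qed.

Fact fps_const_is_zmod_morphism : zmod_morphism fps_const.
Proof. by move=> a b; apply: fpsP => -[|n] //=; rewrite oppr0 addr0. Qed.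
Fact fps_const_is_monoid_morphism : monoid_morphism fps_const.
Proof.
split=> // a b; apply: fpsP => -[|n] /=.
  by rewrite big_ord1.
rewrite big_ord_recl /= mulr0 add0r big1 // => k _.
by rewrite mul0r.
Qed.
HB.instance Definition _ := GRing.isZmodMorphism.Build K (fps K) fps_const
  fps_const_is_zmod_morphism.
HB.instance Definition _ := GRing.isMonoidMorphism.Build K (fps K) fps_const
  fps_const_is_monoid_morphism.

End FpsRing.

(* K[[z, w]] is K[[w]][[z]]: f a b is the coefficient of z^a w^b in f. *)
Notation fps2 K := (fps (fps K)).

Section Fps2.
Variable K : comNzRingType.
Implicit Types f g P Q : fps2 K.

Definition fps2_const (c : K) : fps2 K := fps_const (fps_const c).

HB.instance Definition _ := GRing.RMorphism.copy fps2_const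
  (@fps_const (fps K) \o @fps_const K).

Definition varz : fps2 K := FPS (fun a => FPS (fun b =>
  ((a == 1%N) && (b == 0%N))%:R)).
Definition varw : fps2 K := FPS (fun a => FPS (fun b =>
  ((a == 0%N) && (b == 1%N))%:R)).

Definition diffz f : fps2 K := FPS (fun a => FPS (fun b => f a.+1 b *+ a.+1)).
Definition diffw f : fps2 K := FPS (fun a => FPS (fun b => f a b.+1 *+ b.+1)).

(* The derivative of f along dz/dT = P, dw/dT = Q. *)
Definition diff_along P Q f : fps2 K := diffz f * P + diffw f * Q.

(* The formal series \sum_(j >= 1) s_j f^(j+1) g^j, for f and g without constant
   term: the j-th summand has order at least 2j+1, so the terms with j > a + b
   do not contribute to the coefficient of z^a w^b (see coef_resonant_sum). *)
Definition resonant_sum (s : nat -> K) f g : fps2 K :=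
  FPS (fun a => FPS (fun b =>
    \sum_(1 <= j < (a + b).+1) (fps2_const (s j) * f ^+ j.+1 * g ^+ j) a b)).

Definition order_ge n f := forall a b, (a + b < n)%N -> f a b = 0.

Lemma coef_fps2M f g a b : (f * g) a b =
  \sum_(i < a.+1) \sum_(j < b.+1) f i j * g (a - i)%N (b - j)%N.
Proof. by rewrite coef_fpsM coef_fps_sum. Qed.

Lemma coef_fps2_const c a b :
  fps2_const c a b = c *+ ((a == 0%N) && (b == 0%N)).
Proof. by case: a b => [|a] [|b] //=; rewrite mulr0n. Qed.

Lemma order_geM m n f g :
  order_ge m f -> order_ge n g -> order_ge (m + n) (f * g).
Proof.
move=> fm gn a b abmn; rewrite coef_fps2M big1 // => i _; rewrite big1 // => j _.
case: (ltnP (i + j) m) => [/fm -> | mij]; first by rewrite mul0r.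
rewrite gn ?mulr0 //.
have ia := ltn_ord i; have jb := ltn_ord j; rewrite !ltnS in ia jb.
rewrite -(ltn_add2l m); apply: leq_ltn_trans abmn.
apply: (@leq_trans ((i + j) + (a - i + (b - j)))); first by rewrite leq_add2r.
by rewrite addnACA !subnKC.
Qed.

Lemma order_geX n f k : order_ge n f -> order_ge (n * k) (f ^+ k).
Proof.
move=> fn; elim: k => [|k IHk]; first by rewrite muln0.
by rewrite exprS mulnS; apply: order_geM.
Qed.

Lemma coef_resonant_sum s f g a b N :
    f 0%N 0%N = 0 -> g 0%N 0%N = 0 -> (a + b <= N)%N ->
  resonant_sum s f g a b =
    (\sum_(1 <= j < N.+1) fps2_const (s j) * f ^+ j.+1 * g ^+ j) a b.
Proof.
move=> f0 g0 abN; rewrite !coef_fps_sum /=.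
rewrite [RHS](@big_cat_nat _ _ _ (a + b).+1) //= -[LHS]addr0; congr (_ + _).
rewrite big_nat_cond big1 // => j /andP[/andP[abj _] _].
have ord1 (h : fps2 K) : h 0%N 0%N = 0 -> order_ge 1 h.
  by move=> h0 [|a'] [|b'].
have sj : order_ge 0 (fps2_const (s j)) by [].
apply: (order_geM (order_geM sj (@order_geX _ _ j.+1 (ord1 _ f0)))
  (@order_geX _ _ j (ord1 _ g0))).
by rewrite add0n !mul1n addSn ltnS; apply: leq_trans (leq_addr _ _); apply: ltnW.
Qed.

End Fps2.

Arguments varz {K}.
Arguments varw {K}.

(* dx/dt, dy/dt, du/dt, over any commutative ring: they are evaluated below at
   formal power series with complex coefficients. *)
Section MoonRand.
Variable A : comNzRingType.
Implicit Types c x y u : A.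

Definition moon_rand_x x y u := y.
Definition moon_rand_y x y u := - x - x * u.
Definition moon_rand_u c0 c1 c2 c3 x y u :=
  - c0 * u + c1 * x ^+ 2 + c2 * x * y + c3 * y ^+ 2.
End MoonRand.

Section Complexification.
Variable R : realType.
Implicit Types (c : R) (z w u : fps2 R[i]).

Local Notation "a %:S" := (fps2_const (a : R[i])) (at level 2, format "a %:S").
Local Notation i := ('i%C : R[i]).

Definition real_const c : fps2 R[i] := (c%:C)%C%:S.

(* Solved from z = x + i y and w = x - i y. *)
Definition x_of z w : fps2 R[i] := (2^-1)%:S * (z + w).
Definition y_of z w : fps2 R[i] := (2 * i)^-1%:S * (z - w).

Fact fps2_ii : i%:S * i%:S = -1.
Proof. by rewrite -rmorphM -expr2 sqr_i rmorphN1. Qed.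

Fact fps2_half2 : (2^-1)%:S * 2 = 1.
Proof.
by rewrite -(rmorph_nat (@fps2_const R[i])) -rmorphM mulVf ?pnatr_eq0 // rmorph1.
Qed.

Fact fps2_half_i : (2 * i)^-1%:S = - i%:S * (2^-1)%:S.
Proof.
rewrite -rmorphN -rmorphM; congr fps2_const.
have i_neq0 : i != 0 by rewrite eq_complex /= oner_eq0 andbF.
apply: (mulfI i_neq0); rewrite invfM mulrCA mulfV // mulrA mulrN -expr2.
by rewrite sqr_i opprK mulr1 mul1r.
Qed.

(* The concomitant complex system; T = - i t, so that d/dT = i d/dt. *)
Definition complex_z z w u : fps2 R[i] :=
  i%:S * (moon_rand_x (x_of z w) (y_of z w) u
          + i%:S * moon_rand_y (x_of z w) (y_of z w) u).
Definition complex_w z w u : fps2 R[i] :=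
  i%:S * (moon_rand_x (x_of z w) (y_of z w) u
          - i%:S * moon_rand_y (x_of z w) (y_of z w) u).
Definition complex_u c0 c1 c2 c3 z w u : fps2 R[i] :=
  i%:S * moon_rand_u (real_const c0) (real_const c1) (real_const c2)
           (real_const c3) (x_of z w) (y_of z w) u.

Lemma complex_zE z w u : complex_z z w u = z + (2^-1)%:S * u * (z + w).
Proof.
rewrite /complex_z /x_of /y_of /moon_rand_x /moon_rand_y fps2_half_i.
have ii := fps2_ii; have h2 := fps2_half2.
set I := i%:S in ii *; set h := (2^-1)%:S in h2 *.
transitivity (- (I * I) * (h * (z - w) + h * (z + w) + h * (z + w) * u)).
  by ring.
rewrite ii; transitivity (h * 2 * z + h * u * (z + w)); first by ring.
by rewrite h2 mul1r.
Qed.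

Lemma complex_wE z w u : complex_w z w u = - w - (2^-1)%:S * u * (z + w).
Proof.
rewrite /complex_w /x_of /y_of /moon_rand_x /moon_rand_y fps2_half_i.
have ii := fps2_ii; have h2 := fps2_half2.
set I := i%:S in ii *; set h := (2^-1)%:S in h2 *.
transitivity (I * I * (h * (z + w) - h * (z - w) + h * (z + w) * u)).
  by ring.
rewrite ii; transitivity (- (h * 2 * w) - h * u * (z + w)); first by ring.
by rewrite h2 mul1r.
Qed.

Lemma complex_uE c0 c1 c2 c3 z w u :
  complex_u c0 c1 c2 c3 z w u =
    - (i * c0%:C%C)%:S * u
    + (4^-1 * i * (c1%:C%C - c3%:C%C - i * c2%:C%C))%:S * z ^+ 2
    + (2^-1 * i * (c1%:C%C + c3%:C%C))%:S * z * w
    + (4^-1 * i * (c1%:C%C - c3%:C%C + i * c2%:C%C))%:S * w ^+ 2.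
Proof.
have -> : 4^-1 = 2^-1 * 2^-1 :> R[i] by rewrite -invfM -natrM.
rewrite !(rmorphM, rmorphD, rmorphN) /complex_u /moon_rand_u /x_of /y_of.
rewrite /real_const fps2_half_i.
have ii := fps2_ii; have h2 := fps2_half2.
set I := i%:S in ii *; set h := (2^-1)%:S in h2 *.
set C0 := (c0%:C)%C%:S; set C1 := (c1%:C)%C%:S.
set C2 := (c2%:C)%C%:S; set C3 := (c3%:C)%C%:S.
have e13 : h * I * (C1 + C3) * z * w = h * 2 * h * I * (C1 + C3) * z * w.
  by rewrite h2 mul1r.
rewrite e13.
transitivity (- (I * C0) * u + I * C1 * (h * (z + w)) ^+ 2
  - I * I * h * h * C2 * (z + w) * (z - w)
  + I * (I * I) * C3 * (h * (z - w)) ^+ 2); first by ring.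
rewrite ii; transitivity (- (I * C0) * u
  + h * h * I * (C1 - C3) * (z ^+ 2 + w ^+ 2)
  - h * h * (I * I) * C2 * (z ^+ 2 - w ^+ 2)
  + h * 2 * h * I * (C1 + C3) * z * w); last by ring.
by rewrite ii; ring.
Qed.

Definition is_center_manifold c0 c1 c2 c3 u :=
  [/\ u 0%N 0%N = 0, u 1%N 0%N = 0, u 0%N 1%N = 0 &
      diff_along (complex_z varz varw u) (complex_w varz varw u) u
      = complex_u c0 c1 c2 c3 varz varw u].

(* (xi, eta) puts the planar system dz/dT = P, dw/dT = Q into the normal form
   with coefficients p, q (p 0 and q 0 are not used). The coefficient d_(k+1)k
   of eta is the one of w^(k+1) z^k. *)
Definition is_normalization (P Q xi eta : fps2 R[i]) (p q : nat -> R[i]) :=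
  [/\ [/\ xi 0%N 0%N = 0, xi 1%N 0%N = 1 & xi 0%N 1%N = 0],
      [/\ eta 0%N 0%N = 0, eta 1%N 0%N = 0 & eta 0%N 1%N = 1],
      forall k, (1 <= k)%N -> xi k.+1 k = 0 /\ eta k k.+1 = 0,
      diff_along P Q xi = xi + resonant_sum p xi eta
    & diff_along P Q eta = - eta - resonant_sum q eta xi].

(* For c0 != 0 such u, xi, eta, p, q exist and are unique (p and q from index 1),
   so quantifying them existentially expresses "p_k = q_k = 0 for the p and q of
   the system". *)
Definition isochronous_center c0 c1 c2 c3 :=
  exists u xi eta : fps2 R[i], exists p q : nat -> R[i],
    [/\ is_center_manifold c0 c1 c2 c3 u,
        is_normalization (complex_z varz varw u) (complex_w varz varw u)
          xi eta p q
      & forall k, (1 <= k)%N -> p k = 0 /\ q k = 0].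

End Complexification.

(* Main.v *)
Require Import Defs.
From mathcomp Require Import all_boot all_order all_algebra.
From mathcomp Require Import reals complex ring lra.
Import Order.TTheory GRing.Theory Num.Theory.
Local Open Scope ring_scope.

(** With p = q = 0 the normal form is linear: D xi = xi and D eta = - eta, where
   D is the derivation along the reduced system. The resonant coefficients of
   z^2 w in D xi and of z w^2 in D eta force the quadratic part of u to be
   m (- z^2 + z w - w^2). The center manifold equation then gives u_22 = 0 and
   (2 + i c0) u_31 = 3/2 m^2, whereas the resonant coefficient of z^3 w^2 in
   D xi = xi gives u_31 = 3/8 m^2. Hence (i c0 - 2) m^2 = 0, so that m = 0; then
   the quadratic part of u vanishes, and with it c1, c2 and c3. *)

(** * Coefficients of products of double power series *)

Section Fps2Coefficients.
Variable K : comNzRingType.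
Implicit Types (f : fps2 K) (c : K) (s : nat -> K).

Lemma coef_varzM f a b :
  (varz * f) a b = if a is a'.+1 then f a' b else 0.
Proof.
have zE k : (varz : fps2 K) k = (k == 1%N)%:R.
  by apply: fpsP => n; case: k n => [|[|k]] [|n] /=.
rewrite coef_fpsM big_ord_recl zE mul0r add0r.
case: a => [|a]; first by rewrite big_ord0 coef_fps0.
rewrite big_ord_recl zE mul1r subSS subn0 big1 ?addr0 // => k _.
by rewrite zE mul0r.
Qed.

Lemma coef_varwM f a b :
  (varw * f) a b = if b is b'.+1 then f a b' else 0.
Proof.
have wS k : (varw : fps2 K) k.+1 = 0 by apply: fpsP => n; rewrite coef_fps0.
rewrite coef_fpsM big_ord_recl big1 => [|k _]; last by rewrite wS mul0r.
rewrite addr0 subn0 coef_fpsM big_ord_recl mul0r add0r.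
case: b => [|b]; first by rewrite big_ord0.
rewrite big_ord_recl mul1r subSS subn0 big1 ?addr0 // => k _.
by rewrite mul0r.
Qed.

Lemma coef_fps2_constM c f a b : (fps2_const c * f) a b = c * f a b.
Proof.
(* A constant of [fps2 K] is a constant of constants, so this is applied over [fps K] and then over
   [K]. *)
have constM (A : comNzRingType) (x : A) (g : fps A) n :
    (fps_const x * g) n = x * g n.
  rewrite coef_fpsM big_ord_recl big1 ?addr0 ?subn0 // => k _.
  by rewrite /= mul0r.
by rewrite /fps2_const !constM.
Qed.

Lemma coef_fps2_0 a b : (0 : fps2 K) a b = 0.
Proof. by rewrite !coef_fps0. Qed.

Lemma resonant_sum_eq0 s f g :
  (forall k, (1 <= k)%N -> s k = 0) -> resonant_sum s f g = 0.
Proof.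
move=> s0; apply: fpsP => a; apply: fpsP => b; rewrite coef_fps2_0.
transitivity (\sum_(1 <= j < (a + b).+1)
  (fps2_const (s j) * (f ^+ j.+1 * g ^+ j)) a b).
  by apply: eq_bigr => j _; rewrite mulrA.
rewrite big_nat_cond big1 // => j /andP[/andP[j1 _] _].
by rewrite coef_fps2_constM s0 ?mul0r.
Qed.

End Fps2Coefficients.

(** * The derivation along the reduced system and the obstruction to linearizing it *)

Section CenterManifoldFlow.
Variable K : numFieldType.
Implicit Types (f u xi eta : fps2 K).

(** The nonlinearity shared, with opposite signs, by both reduced equations; it starts in degree 3
    when [u] starts in degree 2. *)
Definition cubic_part u : fps2 K := fps2_const 2^-1 * u * (varz + varw).

Definition flow u f :=
  diff_along (varz + cubic_part u) (- varw - cubic_part u) f.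

Lemma coef_cubic_part u a b : cubic_part u a b =
  2^-1 * ((if a is a'.+1 then u a' b else 0)
          + (if b is b'.+1 then u a b' else 0)).
Proof.
rewrite /cubic_part -mulrA coef_fps2_constM [u * _]mulrC mulrDl !coef_fpsD.
by rewrite coef_varzM coef_varwM.
Qed.

(* The convolution is a fold over concrete lists, so that [/=] expands it at
   given indices. *)
Lemma coef_flow u f a b : flow u f a b = (a%:R - b%:R) * f a b
  + foldr (fun i s => foldr (fun j t =>
      (f i.+1 j *+ i.+1 - f i j.+1 *+ j.+1) * cubic_part u (a - i)%N (b - j)%N
      + t)
      0 (iota 0 b.+1) + s) 0 (iota 0 a.+1).
Proof.
rewrite /flow /diff_along; set g := cubic_part u.
(* The linear part is diagonal, multiplying z^a w^b by a - b; the two nonlinear terms collect into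
   one product. *)
have -> : diffz f * (varz + g) + diffw f * (- varw - g) =
  (varz * diffz f - varw * diffw f) + (diffz f - diffw f) * g by ring.
rewrite [LHS]coef_fpsD; congr (_ + _).
  rewrite !(coef_fpsD, coef_fpsN) coef_varzM coef_varwM mulrBl !mulr_natl.
  by case: a b => [|a] [|b].
rewrite coef_fps2M.
have sumE n (F : nat -> K) :
    \sum_(i < n) F i = foldr (fun i s => F i + s) 0 (iota 0 n).
  by rewrite -(big_mkord xpredT F) unlock /index_iota subn0.
rewrite (sumE _ (fun i =>
  \sum_(j < b.+1) (diffz f - diffw f) i j * g (a - i)%N (b - j)%N)).
elim: (iota 0 a.+1) => //= i r ->.
by rewrite (sumE _ (fun j => (diffz f - diffw f) i j * g (a - i)%N (b - j)%N)).
Qed.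

Lemma flow0 f : flow 0 f = varz * diffz f - varw * diffw f.
Proof.
rewrite /flow /diff_along /cubic_part mulr0 mul0r addr0 subr0 mulrN.
by rewrite ![_ * varz]mulrC ![_ * varw]mulrC.
Qed.

Lemma flow0_varz : flow 0 varz = varz.
Proof.
have dz : diffz varz = 1 :> fps2 K.
  by apply: fpsP => -[|a]; apply: fpsP => -[|b]; rewrite /= ?mul0rn.
have dw : diffw varz = 0 :> fps2 K.
  by apply: fpsP => a; apply: fpsP => b; rewrite /= andbF !mul0rn coef_fps2_0.
by rewrite flow0 dz dw mulr1 mulr0 subr0.
Qed.

Lemma flow0_varw : flow 0 varw = - varw.
Proof.
have dz : diffz varw = 0 :> fps2 K.
  by apply: fpsP => a; apply: fpsP => b; rewrite /= !mul0rn coef_fps2_0.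
have dw : diffw varw = 1 :> fps2 K.
  by apply: fpsP => -[|a]; apply: fpsP => -[|b]; rewrite /= ?mul0rn.
by rewrite flow0 dz dw mulr1 mulr0 sub0r.
Qed.

Lemma flow00 : flow 0 0 = 0.
Proof.
have dz : diffz 0 = 0 :> fps2 K.
  apply: fpsP => a; apply: fpsP => b.
  by rewrite -[LHS]/((0 : fps2 K) a.+1 b *+ a.+1) !coef_fps2_0 mul0rn.
have dw : diffw 0 = 0 :> fps2 K.
  apply: fpsP => a; apply: fpsP => b.
  by rewrite -[LHS]/((0 : fps2 K) a b.+1 *+ b.+1) !coef_fps2_0 mul0rn.
by rewrite flow0 dz dw !mulr0 subr0.
Qed.

Definition quadratic (c20 c11 c02 : K) : fps2 K :=
  fps2_const c20 * (varz * varz) + fps2_const c11 * (varz * varw)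
  + fps2_const c02 * (varw * varw).

Lemma coef_quadratic c20 c11 c02 a b : quadratic c20 c11 c02 a b =
  match a, b with 2, 0 => c20 | 1, 1 => c11 | 0, 2 => c02 | _, _ => 0 end.
Proof.
rewrite /quadratic !coef_fpsD !coef_fps2_constM !coef_varzM coef_varwM.
by case: a b => [|[|[|a]]] [|[|[|b]]] /=; rewrite ?mulr0 ?mulr1 ?addr0 ?add0r.
Qed.

Lemma quadratic0 : quadratic 0 0 0 = 0.
Proof. by rewrite /quadratic !rmorph0 !mul0r !addr0. Qed.

(** Here [c] stands for i c0. The condition [c != 0] allows solving for u_22, and [c != 2] cancels
    the last factor in front of m^2. *)
Lemma linear_flow_quadratic u xi eta c c20 c11 c02 :
    c != 0 -> c != 2 ->
    [/\ u 0%N 0%N = 0, u 1%N 0%N = 0 & u 0%N 1%N = 0] ->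
    flow u u = fps2_const (- c) * u + quadratic c20 c11 c02 ->
    [/\ xi 0%N 0%N = 0, xi 1%N 0%N = 1, xi 0%N 1%N = 0 & xi 2%N 1%N = 0] ->
    [/\ eta 0%N 0%N = 0, eta 1%N 0%N = 0, eta 0%N 1%N = 1 & eta 1%N 2%N = 0] ->
    flow u xi = xi -> flow u eta = - eta ->
  [/\ c20 = 0, c11 = 0 & c02 = 0].
Proof.
move=> c_neq0 c_neq2 [u00 u10 u01] uE [xi00 xi10 xi01 xi21].
move=> [eta00 eta10 eta01 eta12] xiE etaE.
have Du a b : - c * u a b + match a, b with
    2%N, 0%N => c20 | 1%N, 1%N => c11 | 0%N, 2%N => c02 | _, _ => 0 end
    = flow u u a b.
  by rewrite -coef_quadratic -coef_fps2_constM -!coef_fpsD uE.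
have Dxi a b : xi a b = flow u xi a b by rewrite xiE.
have Deta a b : - eta a b = flow u eta a b by rewrite etaE.
(* Each coefficient equation is affine in the quantity sought; [k] is the inverse of the factor of
   that quantity in [l - r]. *)
have eq_of_multiple (k l r x y : K) : l = r -> x - y = k * (l - r) -> x = y.
  by move=> -> /eqP; rewrite subrr mulr0 subr_eq0 => /eqP.
pose natE := (subSS, subn0).
pose lowE := (u00, u10, u01, xi00, xi10, xi01, xi21, eta00, eta10, eta01, eta12).
set m := u 1%N 1%N.
(* In degree 3 the nonlinear part of D xi sees only the linear term of xi. At z^2 w the diagonal
   factor is 2 - 1, so xi_21 cancels and (u_20 + u_11) / 2 = 0 remains. *)
have u20 : u 2%N 0%N = - m.
  have := Dxi 2%N 1%N; rewrite coef_flow /= !coef_cubic_part /=.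
  rewrite !natE !lowE => e.
  by apply: (eq_of_multiple (-2) _ _ _ _ e); rewrite /m; field.
have u02 : u 0%N 2%N = - m.
  have := Deta 1%N 2%N; rewrite coef_flow /= !coef_cubic_part /=.
  rewrite !natE !lowE => e.
  by apply: (eq_of_multiple 2 _ _ _ _ e); rewrite /m; field.
(* Nonresonant coefficients of xi are solved for with divisor a - b - 1. Those of degree 2 and 3 are
   what the z^3 w^2 equation needs. *)
have xi20 : xi 2%N 0%N = 0.
  have := Dxi 2%N 0%N; rewrite coef_flow /= !coef_cubic_part /=.
  rewrite !natE !lowE => e.
  by apply: (eq_of_multiple (-1) _ _ _ _ e); field.
have xi11 : xi 1%N 1%N = 0.
  have := Dxi 1%N 1%N; rewrite coef_flow /= !coef_cubic_part /=.
  rewrite !natE !lowE => e.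
  by apply: (eq_of_multiple 1 _ _ _ _ e); field.
have xi02 : xi 0%N 2%N = 0.
  have := Dxi 0%N 2%N; rewrite coef_flow /= !coef_cubic_part /=.
  rewrite !natE !lowE => e.
  by apply: (eq_of_multiple 3^-1 _ _ _ _ e); field.
have xi30 : xi 3%N 0%N = m / 4.
  have := Dxi 3%N 0%N; rewrite coef_flow /= !coef_cubic_part /=.
  rewrite !natE !lowE u20 => e.
  by apply: (eq_of_multiple (- 2^-1) _ _ _ _ e); field.
have xi12 : xi 1%N 2%N = 0.
  have := Dxi 1%N 2%N; rewrite coef_flow /= !coef_cubic_part /=.
  rewrite !natE !lowE u02 -/m => e.
  by apply: (eq_of_multiple 2^-1 _ _ _ _ e); field.
have xi03 : xi 0%N 3%N = - m / 8.
  have := Dxi 0%N 3%N; rewrite coef_flow /= !coef_cubic_part /=.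
  rewrite !natE !lowE u02 -/m => e.
  by apply: (eq_of_multiple 4^-1 _ _ _ _ e); field.
(* As (- z^2 + z w - w^2) (z + w) = - (z^3 + w^3), the nonlinear part of D u in degree 4 is 3/2 m^2
   (z - w) (z^3 + w^3): no z^2 w^2 term, and - 3/2 m^2 at z^3 w. *)
have u22 : u 2%N 2%N = 0.
  have := Du 2%N 2%N; rewrite coef_flow /= !coef_cubic_part /=.
  rewrite !natE !lowE u20 u02 -/m => e.
  by apply: (eq_of_multiple (- c^-1) _ _ _ _ e); field.
have u31 : u 3%N 1%N * (2 + c) = 3 / 2 * m ^+ 2.
  have := Du 3%N 1%N; rewrite coef_flow /= !coef_cubic_part /=.
  rewrite !natE !lowE u20 u02 -/m => e.
  by apply: (eq_of_multiple (- 1) _ _ _ _ e); field.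
have u31_resonant : u 3%N 1%N = 3 / 8 * m ^+ 2.
  have := Dxi 3%N 2%N; rewrite coef_flow /= !coef_cubic_part /=.
  rewrite !natE !lowE
    u20 u02 xi20 xi11 xi02 xi30 xi12 xi03 u22 -/m => e.
  by apply: (eq_of_multiple (- 2) _ _ _ _ e); field.
have m0 : m = 0.
  have /eqP : 3 / 8 * (c - 2) * m ^+ 2 = 0.
    by rewrite u31_resonant in u31; apply: (eq_of_multiple 1 _ _ _ _ u31); field.
  rewrite !mulf_eq0 subr_eq0 (negPf c_neq2) invr_eq0 !pnatr_eq0 /=.
  by rewrite orbb => /eqP.
(* In degree 2, D u has only its diagonal part, so the forcing coefficients are multiples of the
   vanishing u_20, u_11 and u_02. *)
split.
- have := Du 2%N 0%N; rewrite coef_flow /= !coef_cubic_part /=.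
  rewrite !natE !lowE u20 m0 => e.
  by apply: (eq_of_multiple 1 _ _ _ _ e); field.
- have := Du 1%N 1%N; rewrite coef_flow /= !coef_cubic_part /=.
  rewrite !natE !lowE -/m m0 => e.
  by apply: (eq_of_multiple 1 _ _ _ _ e); field.
- have := Du 0%N 2%N; rewrite coef_flow /= !coef_cubic_part /=.
  rewrite !natE !lowE u02 m0 => e.
  by apply: (eq_of_multiple 1 _ _ _ _ e); field.
Qed.

End CenterManifoldFlow.

(** * Application to the Moon-Rand system *)

Section ComplexSystem.
Variable R : realType.
Implicit Types (f u : fps2 R[i]).

Local Notation i := ('i%C : R[i]).

Lemma diff_along_complexE u f :
  diff_along (complex_z varz varw u) (complex_w varz varw u) f = flow R[i] u f.
Proof. by rewrite complex_zE complex_wE. Qed.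

Lemma complex_u_quadratic c0 c1 c2 c3 u :
  complex_u c0 c1 c2 c3 varz varw u = fps2_const (- (i * c0%:C%C)) * u
    + quadratic R[i] (4^-1 * i * (c1%:C%C - c3%:C%C - i * c2%:C%C))
        (2^-1 * i * (c1%:C%C + c3%:C%C))
        (4^-1 * i * (c1%:C%C - c3%:C%C + i * c2%:C%C)).
Proof.
by rewrite complex_uE /quadratic !expr2 rmorphN -[_ * varz * varw]mulrA !addrA.
Qed.

End ComplexSystem.

Theorem theorem4p1 (R : realType) (c0 c1 c2 c3 : R) (c0_gt0 : 0 < c0) :
  isochronous_center c0 c1 c2 c3 <-> [/\ c1 = 0, c2 = 0 & c3 = 0].
Proof.
split=> [|[-> -> ->]]; last first.
  (* Without forcing the center manifold is u = 0, and the reduced system is already linear. *)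
  exists 0, varz, varw, (fun=> 0), (fun=> 0); split=> //.
    split; rewrite ?coef_fps2_0 //.
    rewrite diff_along_complexE flow00 complex_u_quadratic.
    by rewrite !rmorph0 !(mulr0, addr0, subr0) quadratic0 addr0.
  split; rewrite ?resonant_sum_eq0 ?diff_along_complexE //.
  - by case.
  - by rewrite addr0 flow0_varz.
  - by rewrite subr0 flow0_varw.
case=> u [xi [eta [p [q [[u00 u10 u01 uE] nf pq0]]]]].
have [[xi00 xi10 xi01] [eta00 eta10 eta01] res0 xiE etaE] := nf.
have [xi21 eta12] := res0 1%N isT.
rewrite diff_along_complexE resonant_sum_eq0 ?addr0 in xiE;
  last by move=> k /pq0[].
rewrite diff_along_complexE resonant_sum_eq0 ?subr0 in etaE;
  last by move=> k /pq0[].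
rewrite diff_along_complexE complex_u_quadratic in uE.
(* A nonzero purely imaginary number is neither 0 nor 2. *)
have ic0 : 'i%C * c0%:C%C = (0 +i* c0)%C :> R[i].
  by apply/eqP; rewrite eq_complex /= !mul0r mulr0 mul1r subr0 add0r !eqxx.
have c_neq0 : 'i%C * c0%:C%C != 0 :> R[i].
  by rewrite ic0 eq_complex /= (gt_eqF c0_gt0) andbF.
have c_neq2 : 'i%C * c0%:C%C != 2 :> R[i].
  by rewrite ic0 eq_complex /= addr0 (gt_eqF c0_gt0) andbF.
have [] := linear_flow_quadratic _ _ _ _ _ _ _ _ c_neq0 c_neq2
  (And3 u00 u10 u01) uE (And4 xi00 xi10 xi01 xi21)
  (And4 eta00 eta10 eta01 eta12) xiE etaE.
have i_neq0 : 'i%C != 0 :> R[i] by rewrite eq_complex /= oner_eq0 andbF.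
move=> /eqP; rewrite !mulf_eq0 invr_eq0 pnatr_eq0 (negPf i_neq0) /=.
rewrite eq_complex /= => /andP[/eqP re20 /eqP im20].
move=> /eqP; rewrite !mulf_eq0 invr_eq0 pnatr_eq0 (negPf i_neq0) /=.
rewrite eq_complex /= => /andP[/eqP re11 _] _.
(* The z^2 coefficient gives c1 = c3 and c2 = 0; the z w coefficient gives c1 + c3 = 0. *)
by split; lra.
Qed.
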